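(* Consider a sequence of instances of the model below indexed by $n\to\infty$, where $G=G_n$ is an arbitrary (deterministic) graph on $n$ vertices with average degree $d=d_n$ and $\varepsilon=\varepsilon_n\in(0,1/2)$ may depend on $n$. Let $0<\tau<2/3$ be fixed and assume $d\le n^{\tau}$. If exact recovery with high probability is possible, then $$\frac{d}{\log n}\ \ge\ \frac{1-3\tau/2}{D(1/2\,\|\,\varepsilon)}-\frac{1}{\log n}+o\!\left(\frac{1}{D(1/2\,\|\,\varepsilon)}\right).$$ In particular, if $\varepsilon\to 1/2$, this necessary condition implies $$\frac{d}{\log n}\ \ge\ \frac{2(1-3\tau/2)}{(1-2\varepsilon)^2}+o\!\left(\frac{1}{(1-2\varepsilon)^2}\right).$$
   Context: Model: $G=(V,E)$ is a simple undirected graph with $V=[n]$, $m=|E|$, and incidence matrix $B_G\in\{0,1\}^{m\times n}$ ($B_G(e,v)=1$ iff edge $e$ is incident to vertex $v$). An unknown vector $x\in\{0,1\}^n$ (uniform prior) is observed through $Y=B_G x\oplus Z\in\{0,1\}^m$, i.e. $Y_{(i,j)}=x_i\oplus x_j\oplus Z_{(i,j)}$, where all arithmetic is modulo 2 and $Z$ has i.i.d. Bernoulli$(\varepsilon)$ entries, $\varepsilon\in[0,1/2]$. Exact recovery with high probability means there is a decoder (equivalently, the maximum-likelihood decoder) which, from $Y$ (and knowledge of $G,\varepsilon$), outputs an element of $\{x,\ x\oplus 1^n\}$ with probability tending to $1$ as $n\to\infty$. The average degree is $d=2|E|/n$. All logarithms are natural, and $D(1/2\,\|\,\varepsilon)=\tfrac12\log\frac{1}{2\varepsilon}+\tfrac12\log\frac{1}{2(1-\varepsilon)}$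 is the Kullback–Leibler divergence between Bernoulli$(1/2)$ and Bernoulli$(\varepsilon)$. *)

(* Defs.v *)
From mathcomp Require Import all_boot.
From Stdlib Require Import Reals.

Set Implicit Arguments.
Unset Strict Implicit.
Unset Printing Implicit Defensive.

(* A simple undirected graph on V = [n] = 'I_n is a symmetric irreflexive
   relation.  Its edges are listed once each, as pairs (i,j) with i < j. *)
Definition simple_graph (n : nat) (G : rel 'I_n) : Prop :=
  (forall i j, G i j = G j i) /\ (forall i, G i i = false).

Definition edge (n : nat) (G : rel 'I_n) : Type :=
  {p : 'I_n * 'I_n | (p.1 < p.2)%N && G p.1 p.2}.

Definition num_edges (n : nat) (G : rel 'I_n) : nat := #|{: edge G}|.

Definition avg_degree (n : nat) (G : rel 'I_n) : R :=
  (2 * INR (num_edges G) / INR n)%R.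

Definition observe (n : nat) (G : rel 'I_n) (x : {ffun 'I_n -> bool})
  (z : {ffun edge G -> bool}) : {ffun edge G -> bool} :=
  [ffun e => (x (sval e).1 (+) x (sval e).2) (+) z e].

Definition flip_all (n : nat) (x : {ffun 'I_n -> bool}) : {ffun 'I_n -> bool} :=
  [ffun i => ~~ x i].

(* Probability that the decoder [dec] outputs x or x (+) 1^n, when x is
   uniform on {0,1}^n and Z has i.i.d. Bernoulli(eps) entries. *)
Definition success_prob (n : nat) (G : rel 'I_n) (eps : R)
  (dec : {ffun edge G -> bool} -> {ffun 'I_n -> bool}) : R :=
  \big[Rplus/0%R]_(x : {ffun 'I_n -> bool})
   \big[Rplus/0%R]_(z : {ffun edge G -> bool})
     ((/ 2) ^ n *
      \big[Rmult/1%R]_(e : edge G) (if z e then eps else 1 - eps) *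
      (if (dec (observe x z) == x) || (dec (observe x z) == flip_all x)
       then 1 else 0))%R.

Definition KL_half (eps : R) : R :=
  (/ 2 * ln (/ (2 * eps)) + / 2 * ln (/ (2 * (1 - eps))))%R.

Definition exact_recovery_whp (G : forall n : nat, rel 'I_n) (eps : nat -> R) : Prop :=
  exists dec : forall n : nat, {ffun edge (G n) -> bool} -> {ffun 'I_n -> bool},
    Un_cv (fun n => success_prob (eps n) (dec n)) 1%R.

(* Main.v *)
(** Fix an independent set S of vertices and reveal x outside S.  Each v in S is
    then decoded from its own deg(v) edges only, and independently of the other
    vertices of S, so the success probability is at most
    2 * prod_(v in S) (1 - t_v / 2), where t_v is the probability that exactly
    half (rounded up) of the edges at v are noisy and the factor 2 accounts for
    the global flip.  The central binomial coefficient gives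
    t_v >= exp (- (deg v + 1) D) / O(sqrt (deg v + 1)).  By Markov's inequality a
    constant fraction of the vertices satisfies deg v + 1 <= K := (1 + eta)(d + 1),
    and a maximal independent set among them has size of order n / K.  Success
    therefore forces n K^(-3/2) exp (- K D) = O(1), and d <= n^tau turns
    the exponent 3/2 into the loss 3 tau / 2. *)
From HB Require Import structures.
Require Import Defs.
From mathcomp Require Import all_boot.
From Stdlib Require Import Reals Lra.

Set Implicit Arguments.
Unset Strict Implicit.
Unset Printing Implicit Defensive.

Open Scope R_scope.

(** * Finite sums and products over the reals *)

HB.instance Definition _ := Monoid.isComLaw.Build R 0 Rplus
  (fun x y z => esym (Rplus_assoc x y z)) Rplus_comm Rplus_0_l.
HB.instance Definition _ := Monoid.isComLaw.Build R 1 Rmult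
  (fun x y z => esym (Rmult_assoc x y z)) Rmult_comm Rmult_1_l.
HB.instance Definition _ := Monoid.isMulLaw.Build R 0 Rmult Rmult_0_l Rmult_0_r.
HB.instance Definition _ := Monoid.isAddLaw.Build R Rmult Rplus
  Rmult_plus_distr_r Rmult_plus_distr_l.

Local Notation "\Sum_ ( i 'in' A ) F" := (\big[Rplus/0]_(i in A) F)
  (at level 41, F at level 41, i, A at level 50).
Local Notation "\Sum_ ( i | P ) F" := (\big[Rplus/0]_(i | P%B) F)
  (at level 41, F at level 41, i at level 50).
Local Notation "\Sum_ ( i : T ) F" := (\big[Rplus/0]_(i : T) F)
  (at level 41, F at level 41, i at level 50).
Local Notation "\Prod_ ( i 'in' A ) F" := (\big[Rmult/1]_(i in A) F)
  (at level 36, F at level 36, i, A at level 50).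
Local Notation "\Prod_ ( i <- r ) F" := (\big[Rmult/1]_(i <- r) F)
  (at level 36, F at level 36, i, r at level 50).
Local Notation "\Prod_ i F" := (\big[Rmult/1]_i F)
  (at level 36, F at level 36, i at level 0).

Lemma Rsum_le (I : Type) (r : seq I) (P : pred I) (F H : I -> R) :
  (forall i, P i -> F i <= H i) ->
  \big[Rplus/0]_(i <- r | P i) F i <= \big[Rplus/0]_(i <- r | P i) H i.
Proof. by move=> FH; elim/big_ind2: _ => //; [lra | move=> *; lra]. Qed.

Lemma Rsum_const (I : finType) (P : pred I) (c : R) :
  \Sum_(i | P i) c = INR #|P| * c.
Proof.
rewrite big_const; elim: #|P| => [|k IH]; first by rewrite /=; lra.
rewrite S_INR iterS IH; lra.
Qed.

Lemma Rprod_const (I : finType) (P : pred I) (c : R) :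
  \big[Rmult/1]_(i | P i) c = c ^ #|P|.
Proof. by rewrite big_const; elim: #|P| => [|k IH] //=; rewrite IH. Qed.

Lemma Rprod_pos (I : Type) (r : seq I) (P : pred I) (F : I -> R) :
  (forall i, P i -> 0 < F i) -> 0 < \big[Rmult/1]_(i <- r | P i) F i.
Proof.
by move=> F0; elim/big_ind: _ => //; [lra | move=> *; apply: Rmult_lt_0_compat].
Qed.

Lemma Rprod_le (I : Type) (r : seq I) (P : pred I) (F H : I -> R) :
  (forall i, P i -> 0 <= F i <= H i) ->
  0 <= \big[Rmult/1]_(i <- r | P i) F i <= \big[Rmult/1]_(i <- r | P i) H i.
Proof.
move=> FH; elim/big_ind2: _ => //; first by lra.
move=> x1 x2 y1 y2 [? ?] [? ?]; split; first exact: Rmult_le_pos.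
exact: Rmult_le_compat.
Qed.

Lemma Rprod_le_exp (I : finType) (A : {set I}) (c : I -> R) :
  (forall i, i \in A -> 0 <= 1 - c i) ->
  \Prod_(i in A) (1 - c i) <= exp (- \Sum_(i in A) c i).
Proof.
move=> c1; suff ->: exp (- \Sum_(i in A) c i) = \Prod_(i in A) exp (- c i).
  apply: (proj2 (Rprod_le _ _)) => i iA; split; first exact: c1.
  by move: (exp_ineq1_le (- c i)); lra.
elim/big_rec2: _ => [|i x y _ <-]; first by rewrite Ropp_0 exp_0.
by rewrite -exp_plus; congr exp; lra.
Qed.

(** * The i.i.d. Bernoulli measure on noise vectors *)

Section ProductMeasure.
Variables (E : finType) (eps : R).
Hypothesis eps01 : 0 < eps < 1.
Implicit Types (y z : {ffun E -> bool}) (A : {set E}).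

Definition noise (b : bool) : R := if b then eps else 1 - eps.
Definition mu z : R := \Prod_e noise (z e).
Definition expect (F : {ffun E -> bool} -> R) : R := \Sum_(z : {ffun E -> bool}) (mu z * F z).

Lemma noise_pos b : 0 < noise b.
Proof. by case: b; rewrite /noise; lra. Qed.

Lemma mu_pos z : 0 < mu z.
Proof. by apply: Rprod_pos => e _; apply: noise_pos. Qed.

Lemma sum_prod_ffun (f : E -> bool -> R) :
  \Sum_(z : {ffun E -> bool}) (\Prod_e f e (z e)) = \Prod_e (f e true + f e false).
Proof.
rewrite -(bigA_distr_bigA f); apply: eq_bigr => e _.
by rewrite (bigD1 true) //= (bigD1 false) //= big1 ?Rplus_0_r // => -[].
Qed.

Lemma mu_sum : \Sum_(z : {ffun E -> bool}) mu z = 1.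
Proof.
rewrite /mu (sum_prod_ffun (fun=> noise)) big1 // => e _; rewrite /noise; lra.
Qed.

Lemma expect1 : expect (fun=> 1) = 1.
Proof. by rewrite -[RHS]mu_sum; apply: eq_bigr => z _; rewrite Rmult_1_r. Qed.

Lemma expect_le F H : (forall z, F z <= H z) -> expect F <= expect H.
Proof.
move=> FH; apply: Rsum_le => z _; apply: Rmult_le_compat_l => //.
by have := mu_pos z; lra.
Qed.

Lemma expectD F H : expect (fun z => F z + H z) = expect F + expect H.
Proof.
by rewrite /expect -big_split; apply: eq_bigr => z _ /=; rewrite Rmult_plus_distr_l.
Qed.

Definition depends_on A (F : {ffun E -> bool} -> R) :=
  forall y z, {in A, y =1 z} -> F y = F z.

Definition mix A y z : {ffun E -> bool} := [ffun e => if e \in A then y e else z e].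

Lemma mu_mix A y z : mu (mix A y z) * mu (mix A z y) = mu y * mu z.
Proof.
rewrite /mu -!big_split; apply: eq_bigr => e _ /=; rewrite !ffunE.
by case: (e \in A) => //; rewrite Rmult_comm.
Qed.

(* The involution exchanging the coordinates outside A of two independent
   copies preserves the product measure. *)
Lemma expect_indep A F H :
  depends_on A F -> depends_on (~: A) H ->
  expect (fun z => F z * H z) = expect F * expect H.
Proof.
move=> dF dH; rewrite -[LHS]Rmult_1_r -[X in _ * X]expect1.
rewrite /expect big_distrl [RHS]big_distrl /=.
under eq_bigr do rewrite big_distrr.
under [RHS]eq_bigr do rewrite big_distrr.
rewrite !pair_big /=.
pose h (p : {ffun E -> bool} * {ffun E -> bool}) := (mix A p.1 p.2, mix A p.2 p.1).
have hK : involutive h.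
  by case=> y z; congr pair; apply/ffunP => e; rewrite !ffunE /=; case: (e \in A).
rewrite (reindex_inj (inv_inj hK)); apply: eq_bigr => -[y z] _ /=.
rewrite (dF (mix A y z) y) => [|e eA]; last by rewrite ffunE eA.
rewrite (dH (mix A y z) z) => [|e]; last by rewrite inE ffunE => /negbTE->.
transitivity (mu (mix A y z) * mu (mix A z y) * (F y * H z)); first by lra.
by rewrite mu_mix; lra.
Qed.

(** Induction on [s]: by disjointness the product over the tail depends only on coordinates outside
    [D i], so [expect_indep] splits off the head factor. *)
Lemma expect_prod (I : eqType) (s : seq I) (D : I -> {set E}) F :
  uniq s ->
  {in s &, forall i j, i != j -> [disjoint D i & D j]} ->
  (forall i, depends_on (D i) (F i)) ->
  expect (fun z => \Prod_(i <- s) F i z) = \Prod_(i <- s) expect (F i).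
Proof.
move=> + + dF; elim: s => [|i s IH] /=.
  by rewrite big_nil -[RHS]expect1 => _ _; apply: eq_bigr => z _; rewrite big_nil.
case/andP=> i_s us dis; rewrite big_cons -IH //; last first.
  by move=> j k js ks; apply: dis; rewrite inE ?js ?ks orbT.
rewrite -(@expect_indep (D i)) //.
  by apply: eq_bigr => z _; rewrite big_cons.
move=> y z yz; rewrite !big_seq; apply: eq_bigr => j js; apply: dF => e eDj.
apply: yz; rewrite inE; apply/negP => eDi.
have ij : i != j by apply: contraNneq i_s => ->.
have := dis i j; rewrite !inE eqxx js orbT => /(_ isT isT ij) /pred0P /(_ e) /=.
by rewrite eDi eDj.
Qed.

(** The relative change in probability when one noise bit is flipped; [ratio A z] is then the
    likelihood ratio of flipping every bit of [A]. *)
Definition odds (b : bool) : R := noise (~~ b) / noise b.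
Definition ratio A z : R := \Prod_(e in A) odds (z e).
Definition flip A z : {ffun E -> bool} := [ffun e => (e \in A) (+) z e].

Lemma odds_pos b : 0 < odds b.
Proof. by apply: Rdiv_lt_0_compat; apply: noise_pos. Qed.

Lemma noise_odds b : noise b * odds b = noise (~~ b).
Proof. by rewrite /odds; field; have := noise_pos b; lra. Qed.

Lemma ratio_pos A z : 0 < ratio A z.
Proof. by apply: Rprod_pos => e _; apply: odds_pos. Qed.

Lemma mu_flip A z : mu (flip A z) = mu z * ratio A z.
Proof.
rewrite /mu /ratio [X in _ * X]big_mkcond -big_split; apply: eq_bigr => e _ /=.
by rewrite ffunE; case: (e \in A); rewrite ?noise_odds ?Rmult_1_r.
Qed.

(** Change of variables: [mu z * ratio A z] is the mass of [flip A z], and [flip A] is a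
    bijection. *)
Lemma expect_ratio A : expect (ratio A) = 1.
Proof.
have flipK : involutive (flip A) by move=> z; apply/ffunP => e; rewrite !ffunE addKb.
rewrite -mu_sum (reindex_inj (inv_inj flipK)).
by apply: eq_bigr => z _; rewrite mu_flip.
Qed.

Definition ones A z : {set E} := [set e in A | z e].

(** Rounding up makes the flipped pattern at least as likely as the original when [eps <= / 2], for
    odd [k] too. *)
Definition tie_prob (k : nat) : R :=
  INR 'C(k, uphalf k)%nat * (eps ^ uphalf k * (1 - eps) ^ (k - uphalf k)%nat).

Lemma ratio_ones A z :
  ratio A z = ((1 - eps) / eps) ^ #|ones A z| * (eps / (1 - eps)) ^ (#|A| - #|ones A z|).
Proof.
have sub : ones A z \subset A by apply/subsetP => e; rewrite inE => /andP[].
rewrite -cardsDS // /ratio (big_setID (ones A z)) /=; congr (_ * _).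
  rewrite (setIidPr sub) -Rprod_const; apply: eq_bigr => e.
  by rewrite inE => /andP[_ ->].
rewrite -Rprod_const; apply: eq_bigr => e; rewrite !inE => /andP[+ eA].
by rewrite eA /= => /negbTE->.
Qed.

(** The clean bits cancel against as many noisy ones, which leaves a power of [(1 - eps) / eps]. *)
Lemma ratio_ge1 A z : eps <= / 2 -> #|ones A z| = uphalf #|A| -> 1 <= ratio A z.
Proof.
move=> eps2 cA; rewrite ratio_ones cA; set k := #|A|.
have km : (k - uphalf k <= uphalf k)%nat.
  by rewrite leq_subLR addnn uphalfK leq_addl.
have [j Ej] : exists j, uphalf k = (k - uphalf k + j)%nat.
  by exists (uphalf k - (k - uphalf k))%nat; rewrite subnKC.
rewrite {1}Ej pow_add; set l := (k - _)%nat.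
have -> : forall a b c, a * b * c = (a * c) * b by move=> *; lra.
rewrite -Rpow_mult_distr.
have -> : (1 - eps) / eps * (eps / (1 - eps)) = 1 by field; lra.
rewrite pow1 Rmult_1_l; apply: pow_R1_Rle.
by apply: (Rmult_le_reg_r eps); [lra | field_simplify; lra].
Qed.

Lemma prob_ones A (B : {set E}) : B \subset A ->
  \Sum_(z | ones A z == B) mu z =
  eps ^ #|B| * (1 - eps) ^ (#|A| - #|B|)%nat.
Proof.
move=> sub.
(* The event is a product event: inside [A] each bit must agree with [B], outside it is free. *)
pose f e b := if e \in A then if b == (e \in B) then noise b else 0 else noise b.
transitivity (\Sum_(z : {ffun E -> bool}) (\Prod_e f e (z e))).
  rewrite big_mkcond; apply: eq_bigr => z _; case: eqP => [zB|nB].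
    apply: eq_bigr => e _; rewrite /f -zB inE.
    by case: (e \in A) => //=; rewrite eqxx.
  case: (pickP (fun e => (e \in A) && (z e != (e \in B)))) => [e /andP[eA /negbTE ze]|no].
    by rewrite (bigD1 e) //= {1}/f eA ze Rmult_0_l.
  case: nB; apply/setP => e; rewrite inE; have := no e.
  case: (boolP (e \in A)) => [_ /= /eqP <- //|eA _] /=.
  by apply/esym/negbTE/(contra _ eA)/(subsetP sub).
rewrite sum_prod_ffun (bigID (mem A)) /= [X in _ * X]big1 ?Rmult_1_r; last first.
  by move=> e /negbTE eA; rewrite /f eA /noise; lra.
rewrite -cardsDS // (big_setID B) /= (setIidPr sub) -!Rprod_const; congr (_ * _).
  by apply: eq_bigr => e eB; rewrite /f eB (subsetP sub e eB) /noise /=; lra.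
apply: eq_bigr => e; rewrite inE => /andP[/negbTE eB eA].
by rewrite /f eB eA /noise /=; lra.
Qed.

Lemma prob_tie A :
  expect (fun z => if #|ones A z| == uphalf #|A| then 1 else 0) = tie_prob #|A|.
Proof.
set m := uphalf #|A|.
transitivity (\Sum_(z | #|ones A z| == m) mu z).
  rewrite [RHS]big_mkcond; apply: eq_bigr => z _.
  by case: eqP; rewrite ?Rmult_1_r ?Rmult_0_r.
pose Q (B : {set E}) := (B \subset A) && (#|B| == m).
rewrite (partition_big (ones A) Q) /=; last first.
  move=> z zm; rewrite /Q zm andbT; apply/subsetP => e; by rewrite inE => /andP[].
rewrite /tie_prob -/m -cards_draws.
have -> : \Sum_(B | Q B) (\Sum_(z | (#|ones A z| == m) && (ones A z == B)) mu z)
  = \Sum_(B | Q B) (eps ^ m * (1 - eps) ^ (#|A| - m)%nat).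
  apply: eq_bigr => B /andP[BA /eqP Bm]; rewrite -[in RHS]Bm -prob_ones //.
  by apply: eq_bigl => z; case: (ones A z =P B) => [->|_]; rewrite ?Bm ?eqxx ?andbF.
by rewrite Rsum_const; congr (INR _ * _); apply: eq_card => B; rewrite !inE.
Qed.

(** Pointwise max(1, r) = 1 + r - min(1, r), where min(1, r) dominates the indicator of a tie, and
    both 1 and r have mean 1. Half of the left side is the success probability of the best guess of
    one bit from the edges at its vertex, the other endpoints being known. *)
Lemma expect_max_ratio A :
  eps <= / 2 -> expect (fun z => Rmax 1 (ratio A z)) <= 2 - tie_prob #|A|.
Proof.
move=> eps2; rewrite -prob_tie; set T := expect (fun z => if _ then _ else _).
suff: expect (fun z => Rmax 1 (ratio A z)) + T <= expect (fun=> 1) + expect (ratio A).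
  by rewrite expect1 expect_ratio; lra.
rewrite -!expectD; apply: expect_le => z; have := ratio_pos A z.
case: eqP => [/(ratio_ge1 eps2) ge1 _|_ r0]; first by rewrite Rmax_right //; lra.
by rewrite /Rmax; case: Rle_dec => _; lra.
Qed.

Lemma expect_max_ratio_ge0 A : 0 <= expect (fun z => Rmax 1 (ratio A z)).
Proof.
apply: Rle_trans (expect_le (F := fun=> 1) _); first by rewrite expect1; lra.
by move=> z; apply: Rmax_l.
Qed.

End ProductMeasure.

(** * Decoding on an independent set *)

Section Graph.
Variables (n : nat) (G : rel 'I_n) (eps : R).
Hypothesis eps_half : 0 < eps < / 2.
Implicit Types (x : {ffun 'I_n -> bool}) (y z : {ffun edge G -> bool}) (S : {set 'I_n}).

Definition star (v : 'I_n) : {set edge G} :=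
  [set e : edge G | ((sval e).1 == v) || ((sval e).2 == v)].

Definition independent S : bool :=
  [forall e : edge G, ~~ (((sval e).1 \in S) && ((sval e).2 \in S))].

Lemma edge_neq (e : edge G) : (sval e).1 != (sval e).2.
Proof. by case: e => -[i j] /= /andP[ij _]; rewrite neq_ltn ij. Qed.

Lemma observeK x : involutive (@observe n G x).
Proof. by move=> z; apply/ffunP => e; rewrite !ffunE addKb. Qed.

Lemma observe_flip_all x z : observe (flip_all x) z = observe x z.
Proof. by apply/ffunP => e; rewrite !ffunE; do 2 case: (x _). Qed.

Lemma flip_allK : involutive (@flip_all n).
Proof. by move=> x; apply/ffunP => i; rewrite !ffunE negbK. Qed.

Lemma eps_unit : 0 < eps < 1.
Proof. by lra. Qed.
Local Hint Resolve eps_unit : core.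

(** A union bound over the two accepted outputs. They contribute equally, because [x] and
    [flip_all x] produce the same observation. *)
Lemma success_le_decoded (dec : {ffun edge G -> bool} -> {ffun 'I_n -> bool}) :
  success_prob eps dec <=
  2 * ((/ 2) ^ n * \Sum_(y : {ffun edge G -> bool}) mu eps (observe (dec y) y)).
Proof.
pose c := (/ 2) ^ n; have c0 : 0 < c by apply: pow_lt; lra.
pose T x z := if dec (observe x z) == x then c * mu eps z else 0.
have sumT : \Sum_(x : {ffun 'I_n -> bool}) \Sum_(z : {ffun edge G -> bool}) T x z
  = c * \Sum_(y : {ffun edge G -> bool}) mu eps (observe (dec y) y).
  (* For fixed [x], noise and observation determine each other, so the sum can run over observations
     [y]; then only [x = dec y] survives. *)
  transitivity (\Sum_(x : {ffun 'I_n -> bool})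
    \Sum_(z : {ffun edge G -> bool}) T x (observe x z)).
    by apply: eq_bigr => x _; rewrite (reindex_inj (inv_inj (observeK x))).
  rewrite exchange_big big_distrr; apply: eq_bigr => y _ /=.
  rewrite (bigD1 (dec y)) //= big1 ?Rplus_0_r; last first.
    by move=> x /negbTE xy; rewrite /T observeK eq_sym xy.
  by rewrite /T observeK eqxx.
have sumTf : \Sum_(x : {ffun 'I_n -> bool}) \Sum_(z : {ffun edge G -> bool}) T (flip_all x) z
  = \Sum_(x : {ffun 'I_n -> bool}) \Sum_(z : {ffun edge G -> bool}) T x z.
  by rewrite [RHS](reindex_inj (inv_inj flip_allK)).
rewrite -sumT double -{2}sumTf -big_split; apply: Rsum_le => x _ /=.
rewrite -big_split; apply: Rsum_le => z _ /=; rewrite -/c.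
rewrite /T observe_flip_all; change (\Prod_e _) with (mu eps z).
have c1 : 0 < c * mu eps z by apply: Rmult_lt_0_compat => //; apply: mu_pos.
by case: eqP; case: eqP => _ _ /=; lra.
Qed.

Definition restrict S x : {ffun 'I_n -> bool} := [ffun v => (v \notin S) && x v].

(** Setting [x v] to true flips the implied noise exactly on [star v]. An edge meets an independent
    set at most once, so the effects of different [v] multiply. *)
Lemma mu_observe_restrict S x y : independent S ->
  mu eps (observe x y) = mu eps (observe (restrict S x) y) *
    \Prod_(v in S) (if x v then ratio eps (star v) (observe (restrict S x) y) else 1).
Proof.
move=> /forallP indS; set w := observe (restrict S x) y.
transitivity (mu eps w * \Prod_(v in S) \Prod_e
    (if x v && (e \in star v) then odds eps (w e) else 1)); last first.
  congr (_ * _); apply: eq_bigr => v _; case: (x v); last by rewrite big1.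
  by rewrite /ratio [RHS]big_mkcond.
rewrite exchange_big /mu -big_split; apply: eq_bigr => e _ /=.
have starP v : (e \in star v) = ((sval e).1 == v) || ((sval e).2 == v) by rewrite inE.
(* The case of an edge whose only endpoint in [S] is [v]: all other factors of the product are 1. *)
have step (v : 'I_n) : v \in S -> e \in star v ->
    (forall u, u \in S -> e \in star u -> u = v) ->
    (observe x y) e = x v (+) w e ->
    noise eps (observe x y e) = noise eps (w e) *
    \Prod_(u in S) (if x u && (e \in star u) then odds eps (w e) else 1).
  move=> vS ev uniq_v ->; rewrite (bigD1 v) //= big1 ?Rmult_1_r => [|u /andP[uS uv]].
    by rewrite ev andbT; case: (x v); rewrite ?noise_odds ?Rmult_1_r.
  case: ifP => // /andP[_ eu]; move: uv; by rewrite (uniq_v u) ?eqxx.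
have obsE a : observe a y e = (a (sval e).1 (+) a (sval e).2) (+) y e by rewrite ffunE.
have := indS e; case: (boolP ((sval e).1 \in S)) => e1 /= e2.
  apply: (step (sval e).1) => //; first by rewrite starP eqxx.
    by move=> u uS; rewrite starP => /orP[/eqP//|/eqP eu]; rewrite eu uS in e2.
  by rewrite /w !obsE !ffunE e1 e2 /= addbA.
case: (boolP ((sval e).2 \in S)) => {}e2.
  apply: (step (sval e).2) => //; first by rewrite starP eqxx orbT.
    by move=> u uS; rewrite starP => /orP[/eqP eu|/eqP//]; rewrite eu uS in e1.
  by rewrite /w !obsE !ffunE e1 e2 /= addbF addbA [x _ (+) x _]addbC.
rewrite big1 ?Rmult_1_r; first by rewrite /w !obsE !ffunE e1 e2.
move=> u uS; case: ifP => // /andP[_]; rewrite starP.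
by case/orP=> /eqP eu; rewrite eu uS in e1 e2.
Qed.

Lemma star_disjoint S : independent S ->
  {in S &, forall u v, u != v -> [disjoint star u & star v]}.
Proof.
move=> /forallP indS u v uS vS uv; apply/pred0P => e /=; apply/negP.
rewrite !inE => /andP[/orP[] /eqP eu /orP[] /eqP ev].
- by rewrite -eu -ev eqxx in uv.
- by have := indS e; rewrite eu ev uS vS.
- by have := indS e; rewrite eu ev uS vS.
- by rewrite -eu -ev eqxx in uv.
Qed.

(** Whatever bits [f y] chooses on [S], its likelihood is at most that of [restrict S (f y)] times
    the factors max(1, ratio). Summing over all vectors vanishing on [S] removes the dependence on
    [f]; each contributes the same expectation, and there are [2 ^ (n - #|S|)] of them. *)
Lemma sum_decoded_le S (f : {ffun edge G -> bool} -> {ffun 'I_n -> bool}) :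
  independent S ->
  \Sum_(y : {ffun edge G -> bool}) mu eps (observe (f y) y) <=
  2 ^ (n - #|S|)%nat * \Prod_(v in S) (2 - tie_prob eps #|star v|).
Proof.
move=> indS.
pose rho v z := Rmax 1 (ratio eps (star v) z).
have rho1 v z : 1 <= rho v z by apply: Rmax_l.
pose K z := \Prod_(v in S) rho v z.
have K0 z : 0 < K z by apply: Rprod_pos => v _; have := rho1 v z; lra.
pose offS : {pred {ffun 'I_n -> bool}} := pffun_on false (mem (~: S)) predT.
apply: (Rle_trans _ (\Sum_(y : {ffun edge G -> bool})
   \Sum_(a in offS) (mu eps (observe a y) * K (observe a y)))).
  apply: Rsum_le => y _; rewrite (bigD1 (restrict S (f y))) /=; last first.
    apply/pffun_onP; split=> // ; apply/supportP => v.
    by rewrite inE negbK ffunE => ->.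
  rewrite -[X in X <= _]Rplus_0_r; apply: Rplus_le_compat; last first.
    elim/big_ind: _ => [|? ? ? ?|a _]; [lra | lra |].
    by apply: Rmult_le_pos; apply: Rlt_le => //; apply: mu_pos.
  rewrite (mu_observe_restrict _ _ indS); set w := observe _ y.
  apply: Rmult_le_compat_l; first by apply: Rlt_le; apply: mu_pos.
  apply: (proj2 (Rprod_le _ _)) => v _.
  have := ratio_pos eps_unit (star v) w; have := rho1 v w.
  case: (f y v) => *; split; try lra; exact: Rmax_r.
rewrite exchange_big /=.
have -> : \Sum_(a in offS) \Sum_(y : {ffun edge G -> bool})
    (mu eps (observe a y) * K (observe a y))
  = \Sum_(a in offS) expect eps K.
  by apply: eq_bigr => a _; rewrite [RHS](reindex_inj (inv_inj (observeK a))).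
rewrite Rsum_const /offS card_pffun_on cardsCs setCK card_ord card_bool.
have -> : INR (expn 2 (n - #|S|)) = 2 ^ (n - #|S|).
  by elim: (n - _)%nat => //= k IH; rewrite expnS mult_INR IH.
apply: Rmult_le_compat_l; first by apply: pow_le; lra.
(* Stars of distinct vertices of [S] are disjoint, so the factors are independent. *)
have -> : expect eps K = \Prod_(v in S) expect eps (rho v).
  rewrite -big_enum -(@expect_prod _ _ _ _ star).
  - by apply: eq_bigr => z _; rewrite /K -big_enum.
  - exact: enum_uniq.
  - by move=> u v; rewrite !mem_enum; apply: star_disjoint.
  by move=> v y z yz; congr Rmax; apply: eq_bigr => e /yz ->.
apply: (proj2 (Rprod_le _ _)) => v _; split; first exact: expect_max_ratio_ge0.
by apply: expect_max_ratio => //; lra.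
Qed.

Lemma success_le_exp S (dec : {ffun edge G -> bool} -> {ffun 'I_n -> bool}) :
  independent S ->
  success_prob eps dec <= 2 * exp (- \Sum_(v in S) (tie_prob eps #|star v| / 2)).
Proof.
move=> indS; apply: Rle_trans (success_le_decoded dec) _.
apply: Rmult_le_compat_l; first by lra.
(* The expectation of max(1, ratio) lies between 0 and [2 - tie_prob]. *)
have t2 v : 0 <= 1 - tie_prob eps #|star v| / 2.
  have := expect_max_ratio_ge0 eps_unit (star v).
  by have := @expect_max_ratio _ _ eps_unit (star v); lra.
apply: Rle_trans (Rprod_le_exp (fun v _ => t2 v)).
apply: Rle_trans (Rmult_le_compat_l _ _ _ _ (sum_decoded_le dec indS)) _.
  by apply: pow_le; lra.
have -> : \Prod_(v in S) (2 - tie_prob eps #|star v|) =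
    2 ^ #|S| * \Prod_(v in S) (1 - tie_prob eps #|star v| / 2).
  by rewrite -Rprod_const -big_split; apply: eq_bigr => v _ /=; field.
have Sn : (#|S| <= n)%nat by rewrite -[leqRHS]card_ord max_card.
rewrite -!Rmult_assoc -{1}(subnK Sn) pow_add.
have inv k : (/ 2) ^ k * 2 ^ k = 1.
  by rewrite -Rpow_mult_distr Rinv_l ?pow1 //; lra.
set P := \Prod_(v in S) _.
have -> : forall a b c d, a * b * c * d * P = (a * c) * (b * d) * P by move=> *; lra.
by rewrite !inv; lra.
Qed.

End Graph.

(** * The tie probability *)

Lemma central_binomial_rec m :
  (m.+1 * 'C(m.+1.*2, m.+1) = 2 * (m.*2.+1 * 'C(m.*2, m)))%nat.
Proof.
have sub : (m.*2.+1 - m = m.+1)%nat by rewrite -addnn -addSn addnK.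
have e1 : ('C(m.+1.*2, m.+1) = 2 * 'C(m.*2.+1, m))%nat.
  rewrite doubleS binS -(@bin_sub _ m.+1) ?ltnS -?addnn ?leq_addr //.
  by rewrite subSS addnK addnn -mul2n.
by have := mul_bin_down m.*2.+1 m; rewrite /= sub e1 => ->; rewrite mulnCA.
Qed.

(** The bound C(2m, m) >= 4^m / sqrt(4m + 1), squared to avoid roots. In the induction step the two
    sides differ by an explicit square. *)
Lemma central_binomial_ge m :
  16 ^ m <= INR 'C(m.*2, m) ^ 2 * (4 * INR m + 1).
Proof.
elim: m => [|m IH]; first by rewrite bin0 /=; lra.
have := congr1 INR (central_binomial_rec m).
have dbl : INR m.*2 = 2 * INR m by rewrite -addnn plus_INR; lra.
rewrite !mult_INR !S_INR dbl; set c := INR 'C(m.+1.*2, m.+1).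
move: IH; set b := INR 'C(m.*2, m); set x := INR m => IH rec.
have x0 : 0 <= x by apply: pos_INR.
have {rec} -> : c = 2 * (2 * x + 1) * b / (x + 1).
  apply: (Rmult_eq_reg_l (x + 1)); last by lra.
  by rewrite rec /=; field; lra.
apply: (Rle_trans _ (16 * (b ^ 2 * (4 * x + 1)))); first by rewrite [16 ^ _]/=; lra.
have -> : (2 * (2 * x + 1) * b / (x + 1)) ^ 2 * (4 * (x + 1) + 1) =
  16 * (b ^ 2 * (4 * x + 1)) + 4 * (b / (x + 1)) ^ 2 by field; lra.
have := pow2_ge_0 (b / (x + 1)); lra.
Qed.

(** For odd [k], Pascal's rule splits the left side into two equal binomials; for even [k] the
    factor 2 is slack. *)
Lemma central_binomial_uphalf k :
  ('C((uphalf k).*2, uphalf k) <= 2 * 'C(k, uphalf k))%nat.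
Proof.
rewrite uphalf_half; move: (odd_double_half k).
move: (odd k) (k./2) => [] m <-; last by rewrite !add0n mul2n -[leqRHS]addnn leq_addr.
rewrite !add1n doubleS binS.
rewrite -(@bin_sub _ m.+1) ?ltnS -?addnn ?leq_addr //.
by rewrite subSS addnK mul2n -addnn.
Qed.

(** This turns [4 ^ m * (eps * (1 - eps)) ^ m] into exp(-2mD). *)
Lemma exp_KL_half eps : 0 < eps < 1 ->
  exp (- (2 * KL_half eps)) = 4 * (eps * (1 - eps)).
Proof.
move=> e01; have p1 : 0 < 2 * eps by lra.
have p2 : 0 < 2 * (1 - eps) by lra.
rewrite /KL_half !ln_Rinv //.
have -> : - (2 * (/ 2 * - ln (2 * eps) + / 2 * - ln (2 * (1 - eps)))) =
  ln (2 * eps) + ln (2 * (1 - eps)) by field.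
by rewrite exp_plus !exp_ln //; lra.
Qed.

Lemma KL_half_pos eps : 0 < eps < / 2 -> 0 < KL_half eps.
Proof.
move=> e2; apply: Rnot_le_lt => D0.
have : 1 <= exp (- (2 * KL_half eps)) by have := exp_ineq1_le (- (2 * KL_half eps)); lra.
rewrite exp_KL_half; last by lra.
by have := Rle_0_sqr (1 - 2 * eps); rewrite /Rsqr; nra.
Qed.

(** With [m = uphalf k], the binomial is at least 4^m / (2 sqrt(4m + 1)) and the powers are at least
    [(eps * (1 - eps)) ^ m]. The hypothesis has [k + 1] because 2m reaches it for odd [k]. *)
Lemma tie_prob_ge eps k K : 0 < eps < / 2 -> INR k + 1 <= K ->
  exp (- (K * KL_half eps)) / (2 * sqrt (3 * K)) <= tie_prob eps k.
Proof.
move=> e2 kK; have D0 := KL_half_pos e2; set D := KL_half eps in D0 *.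
have k0 := pos_INR k.
pose m := uphalf k.
have m2k : 2 * INR m <= INR k + 1.
  have /leP/le_INR : (m.*2 <= k + 1)%nat by rewrite uphalfK addnC leq_add2l; case: odd.
  by rewrite -addnn !plus_INR /=; lra.
have kmm : (k - m <= m)%nat by rewrite leq_subLR addnn uphalfK leq_addl.
(* Here 4m + 1 <= 2K + 1 <= 3K, since [K >= 1]. *)
set s := sqrt (3 * K); have s0 : 0 < s by apply: sqrt_lt_R0; lra.
have ss : s * s = 3 * K by apply: sqrt_sqrt; lra.
pose b := INR 'C(m.*2, m).
have b0 : 0 <= b by apply: pos_INR.
have p4 : 0 < 4 ^ m by apply: pow_lt; lra.
have bs : 4 ^ m <= b * s.
  apply: Rsqr_incr_0; rewrite /Rsqr; [|lra|nra].
  rewrite -Rpow_mult_distr; have -> : 4 * 4 = 16 by lra.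
  apply: Rle_trans (central_binomial_ge m) _; rewrite -/b.
  have -> : b * s * (b * s) = b ^ 2 * (s * s) by lra.
  by rewrite ss; apply: Rmult_le_compat_l; [exact: pow2_ge_0 | lra].
have bC : b <= 2 * INR 'C(k, m).
  by have /leP/le_INR := central_binomial_uphalf k; rewrite mult_INR.
have powm : (eps * (1 - eps)) ^ m <= eps ^ m * (1 - eps) ^ (k - m)%nat.
  rewrite Rpow_mult_distr; apply: Rmult_le_compat_l; first by apply: pow_le; lra.
  rewrite -[X in (1 - eps) ^ X <= _](subnK kmm) pow_add.
  rewrite -[X in _ <= X]Rmult_1_l; apply: Rmult_le_compat_r; first by apply: pow_le; lra.
  by rewrite -[X in _ <= X](pow1 (m - (k - m))); apply: pow_incr; lra.
have expm : exp (- (K * D)) <= 4 ^ m * (eps * (1 - eps)) ^ m.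
  rewrite -Rpow_mult_distr -exp_KL_half -/D; last by lra.
  have -> : exp (- (2 * D)) ^ m = exp (- (2 * INR m * D)).
    elim: (m) => [|j IH]; first by rewrite /= Rmult_0_r Rmult_0_l Ropp_0 exp_0.
    by rewrite [LHS]/= IH -exp_plus S_INR; congr exp; lra.
  have mK : 2 * INR m <= K by lra.
  case: (Rle_lt_or_eq_dec _ _ mK) => [?|->]; last exact: Rle_refl.
  by apply: Rlt_le; apply: exp_increasing; nra.
rewrite /tie_prob -/m; set c := INR _; set p := (eps * (1 - eps)) ^ m in powm expm *.
apply: (Rle_trans _ (b / 2 * p)); last first.
  apply: Rmult_le_compat; [lra | by apply: pow_le; nra | | exact: powm].
  by rewrite /c; lra.
apply: (Rmult_le_reg_r (2 * s)); first by lra.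
have -> : exp (- (K * D)) / (2 * s) * (2 * s) = exp (- (K * D)) by field; lra.
apply: Rle_trans expm _.
have -> : b / 2 * p * (2 * s) = b * s * p by field.
by apply: Rmult_le_compat_r => //; apply: pow_le; nra.
Qed.

(** * Low-degree independent sets *)

Lemma INR_sum (I : Type) (r : seq I) (P : pred I) (F : I -> nat) :
  INR (\sum_(i <- r | P i) F i)%nat = \big[Rplus/0]_(i <- r | P i) INR (F i).
Proof. by elim/big_rec2: _ => // i x y _ <-; rewrite plus_INR. Qed.

Lemma card_bigcup_le (I T : finType) (A : {set I}) (F : I -> {set T}) :
  (#|\bigcup_(i in A) F i| <= \sum_(i in A) #|F i|)%nat.
Proof.
elim/big_rec2: _ => [|i y1 y2 _ le]; first by rewrite cards0.
by apply: leq_trans (leq_card_setU _ _) _; rewrite leq_add2l.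
Qed.

Section Degrees.
Variables (n : nat) (G : rel 'I_n).

Lemma handshake : (\sum_(v < n) #|star G v| = 2 * num_edges G)%nat.
Proof.
under eq_bigr do rewrite -sum1_card big_mkcond /=.
rewrite exchange_big /= mulnC /num_edges -sum_nat_const; apply: eq_bigr => e _.
rewrite -big_mkcond /= -[RHS](_ : #|[set (sval e).1; (sval e).2]| = 2)%nat; last first.
  by rewrite cards2 edge_neq.
by rewrite -sum1_card; apply: eq_bigl => v; rewrite !inE ![v == _]eq_sym.
Qed.

(* A maximal independent subset of W dominates W. *)
Lemma exists_independent (W : {set 'I_n}) :
  exists2 S : {set 'I_n}, independent G S && (S \subset W) &
    (#|W| <= \sum_(v in S) #|star G v|.+1)%nat.
Proof.
have ind0 : independent G set0 && (set0 \subset W).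
  by rewrite sub0set andbT; apply/forallP => e; rewrite inE.
have [S /maxsetP[/andP[indS SW] maxS] _] :=
  maxset_exists (P := fun S => independent G S && (S \subset W)) ind0.
exists S; first by rewrite indS.
(* The far endpoint of an edge at [v]; closed neighbourhoods of [S] will cover [W]. *)
pose other v (e : edge G) := if (sval e).1 == v then (sval e).2 else (sval e).1.
apply: (@leq_trans #|\bigcup_(v in S) (v |: [set other v e | e in star G v])|); last first.
  apply: leq_trans (card_bigcup_le _ _) _; apply: leq_sum => v _.
  apply: leq_trans (leq_card_setU _ _) _; rewrite cards1 add1n ltnS.
  exact: leq_imset_card.
apply/subset_leq_card/subsetP => w wW; apply/bigcupP.
case: (boolP (w \in S)) => wS; first by exists w => //; rewrite setU11.
(* By maximality of [S], adding [w] creates an edge; it must join [w] to a vertex of [S]. *)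
have /forallPn[e] : ~~ independent G (w |: S).
  apply: contra wS => ind; rewrite -(maxS (w |: S)) ?setU11 //; last exact: subsetUr.
  by rewrite ind subUset sub1set wW.
rewrite negbK !inE => /andP[/orP[/eqP e1|e1] /orP[/eqP e2|e2]].
- by have := edge_neq e; rewrite e1 e2 eqxx.
- exists (sval e).2 => //; rewrite !inE; apply/orP; right; apply/imsetP; exists e.
    by rewrite inE eqxx orbT.
  by rewrite /other (negbTE (edge_neq e)).
- exists (sval e).1 => //; rewrite !inE; apply/orP; right; apply/imsetP; exists e.
    by rewrite inE eqxx.
  by rewrite /other eqxx.
- by have /forallP/(_ e) := indS; rewrite e1 e2.
Qed.

(** Markov's inequality for deg + 1, whose sum is n(d + 1), leaves a set [W] of low-degree vertices
    with n(K - (d + 1)) <= K |W|. Each vertex of [S] dominates at most K of them, so |W| <= K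
    |S|. *)
Lemma exists_low_degree_independent K : (0 < n)%nat -> 0 < K ->
  exists2 S : {set 'I_n}, independent G S &
    (forall v, v \in S -> INR #|star G v| + 1 <= K) /\
    INR n * (K - (avg_degree G + 1)) <= K * (K * INR #|S|).
Proof.
move=> n0 K0; have n0R : 0 < INR n by apply: lt_0_INR; apply/ltP.
pose low v := if Rle_dec (INR #|star G v| + 1) K then true else false.
pose W := [set v | low v].
have [S /andP[indS /subsetP SW] WS] := exists_independent W.
have lowS v : v \in S -> INR #|star G v| + 1 <= K.
  by move=> /SW; rewrite inE /low; case: Rle_dec.
exists S => //; split=> //.
have WKS : INR #|W| <= K * INR #|S|.
  move/leP/le_INR: WS => /Rle_trans; apply; rewrite INR_sum Rmult_comm -Rsum_const.
  by apply: Rsum_le => v vS; rewrite S_INR; apply: lowS.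
suff: INR n * K - INR #|W| * K <= INR n * (avg_degree G + 1) by nra.
have -> : INR n * (avg_degree G + 1) = \Sum_(v : 'I_n) (INR #|star G v| + 1).
  rewrite big_split /= -INR_sum handshake Rsum_const card_ord mult_INR /avg_degree.
  by rewrite [INR 2]/=; field; lra.
have -> : INR n * K - INR #|W| * K = \Sum_(v in ~: W) K.
  rewrite Rsum_const [X in _ = INR X * _](_ : _ = (n - #|W|)%nat); last first.
    by rewrite [LHS]cardsCs setCK card_ord.
  rewrite minus_INR; first by lra.
  by apply/leP; rewrite -[leqRHS]card_ord max_card.
rewrite [X in X <= _]big_mkcond; apply: Rsum_le => v _; rewrite !inE /low.
have := pos_INR #|star G v|; case: Rle_dec => /= *; lra.
Qed.

End Degrees.

Lemma avg_degree_ge0 n (G : rel 'I_n) : (0 < n)%nat -> 0 <= avg_degree G.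
Proof.
move=> n0; apply: Rmult_le_pos; first by have := pos_INR (num_edges G); lra.
by apply: Rlt_le; apply: Rinv_0_lt_compat; apply: lt_0_INR; apply/ltP.
Qed.

(** For this [K], the Markov surplus K - (d + 1) is the fraction eta / (1 + eta) of K, so |S| is at
    least that fraction of n / K. *)
Lemma success_bound n (G : rel 'I_n) eps eta
    (dec : {ffun edge G -> bool} -> {ffun 'I_n -> bool}) :
  (0 < n)%nat -> 0 < eps < / 2 -> 0 < eta ->
  let K := (1 + eta) * (avg_degree G + 1) in
  success_prob eps dec <=
  2 * exp (- (INR n * (eta / (1 + eta)) / K *
              (exp (- (K * KL_half eps)) / (4 * sqrt (3 * K))))).
Proof.
move=> n0 e2 eta0 K; have n0R : 0 < INR n by apply: lt_0_INR; apply/ltP.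
have d0 := avg_degree_ge0 G n0.
have K0 : 0 < K by rewrite /K; nra.
have [S indS [lowS sizeS]] := exists_low_degree_independent G n0 K0.
apply: Rle_trans (success_le_exp e2 dec indS) _.
apply: Rmult_le_compat_l; first by lra.
set q := exp (- (K * _)) / _.
have s0 : 0 < sqrt (3 * K) by apply: sqrt_lt_R0; lra.
have q0 : 0 < q by apply: Rdiv_lt_0_compat; [exact: exp_pos | lra].
set L := INR n * _ / K * q.
have LS : L <= \Sum_(v in S) (tie_prob eps #|star G v| / 2).
  apply: (Rle_trans _ (\Sum_(v in S) q)); last first.
    apply: Rsum_le => v /lowS kK; have := tie_prob_ge e2 kK.
    suff -> : q = exp (- (K * KL_half eps)) / (2 * sqrt (3 * K)) / 2 by lra.
    by rewrite /q; field; lra.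
  rewrite Rsum_const; apply: Rmult_le_compat_r; first by lra.
  apply: (Rmult_le_reg_l (K * K)); first by nra.
  have -> : K * K * (INR n * (eta / (1 + eta)) / K) = INR n * (K - (avg_degree G + 1)).
    by rewrite /K; field; lra.
  by apply: Rle_trans sizeS _; rewrite -Rmult_assoc; apply: Rle_refl.
case: (Rle_lt_or_eq_dec _ _ LS) => [lt|->]; last exact: Rle_refl.
by apply: Rlt_le; apply: exp_increasing; lra.
Qed.

(** * Asymptotics *)

Lemma ln_sqrt x : 0 < x -> ln (sqrt x) = ln x / 2.
Proof.
move=> x0; have s0 := sqrt_lt_R0 x x0.
have := ln_mult _ _ s0 s0; rewrite sqrt_sqrt; lra.
Qed.

Lemma ln_le_mono x y : 0 < x -> x <= y -> ln x <= ln y.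
Proof.
by move=> x0 /Rle_lt_or_eq_dec[/(ln_increasing _ _ x0)|->]; lra.
Qed.

Lemma ln_INR_eventually_ge (M : R) :
  exists N : nat, forall n, (N <= n)%nat -> M <= ln (INR n).
Proof.
have [N NM] := INR_unbounded (exp M); exists N => n /leP/le_INR Nn.
rewrite -[M]ln_exp; apply: ln_le_mono; first exact: exp_pos.
by lra.
Qed.

Section Asymptotics.
Variables (G : forall n : nat, rel 'I_n) (eps : nat -> R) (tau : R).
Arguments G n : clear implicits.
Hypothesis eps_half : forall n, 0 < eps n < / 2.
Hypothesis tau_range : 0 < tau < 2 / 3.
Hypothesis sparse :
  forall n, (0 < n)%nat -> avg_degree (G n) <= Rpower (INR n) tau.
Hypothesis recovery : exact_recovery_whp G eps.

Let d n := avg_degree (G n).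
Let D n := KL_half (eps n).
Let l n := ln (INR n).

(** Success above 2/e forces the exponent [L] of [success_bound] below 1. In [ln L], [ln K] has
    coefficient -3/2: one from |S|, one half from the square root in the tie probability. *)
Lemma recovery_degree_bound eta : 0 < eta ->
  exists C : R, exists N : nat, forall n, (N <= n)%nat ->
    (1 - 3 * tau / 2) * l n - C <= (1 + eta) * ((d n + 1) * D n).
Proof.
move=> eta0; have [dec cv] := recovery.
have e1 : 2 * exp (- 1) < 1.
  have := exp_ineq1 1; have := exp_pos (- 1); have := exp_plus (- 1) 1.
  by rewrite Rplus_opp_l exp_0; nra.
have gap : 1 - 2 * exp (- 1) > 0 by lra.
have [N cvN] := cv _ gap.
pose c := eta / (1 + eta).
have c0 : 0 < c by apply: Rdiv_lt_0_compat; lra.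
(* [C] collects the terms of [ln L < 0] free of n once [ln K] is replaced by its upper bound. *)
exists (- ln c + ln 4 + 3 / 2 * ln (2 * (1 + eta)) + ln 3 / 2), (maxn N 1) => n.
rewrite geq_max => /andP[Nn n0].
have n1 : 1 <= INR n by apply: (le_INR 1); apply/leP.
have d0 := avg_degree_ge0 (G n) n0.
have := success_bound (dec n) n0 (eps_half n) eta0; rewrite /= -/c.
set K := (1 + eta) * (avg_degree (G n) + 1); set s := sqrt (3 * K).
set L := (X in 2 * exp (- X)) => sL.
have K0 : 0 < K by rewrite /K; nra.
have s0 : 0 < s by apply: sqrt_lt_R0; lra.
have L1 : L < 1.
  have := cvN n; rewrite /Rdist => /(_ (leP Nn)) /Rabs_def2 [_ sn].
  by apply: Ropp_lt_cancel; apply: exp_lt_inv; rewrite (_ : - (1) = -1); lra.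
have E0 := exp_pos (- (K * KL_half (eps n))).
have L0 : 0 < L.
  rewrite /L; apply: Rmult_lt_0_compat; apply: Rdiv_lt_0_compat; nra.
have lnL : ln L = l n + ln c - ln K - K * D n - ln 4 - (ln 3 + ln K) / 2.
  have iv x : 0 < x -> 0 < / x by exact: Rinv_0_lt_compat.
  have -> : L = INR n * (c * (/ K * (exp (- (K * D n)) * (/ 4 * / s)))).
    by rewrite /L /D; field; lra.
  have p1 : 0 < / 4 * / s by apply: Rmult_lt_0_compat; apply: iv; lra.
  have p2 := Rmult_lt_0_compat _ _ E0 p1.
  have p3 := Rmult_lt_0_compat _ _ (iv _ K0) p2.
  have p4 := Rmult_lt_0_compat _ _ c0 p3.
  rewrite ln_mult //; last by lra.
  rewrite ln_mult // ln_mult //; last exact: iv.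
  rewrite ln_mult // ln_exp ln_mult; [|by apply: iv; lra|exact: iv].
  rewrite !ln_Rinv //; last by lra.
  rewrite ln_sqrt; last by lra.
  by rewrite (ln_mult 3 K); [rewrite /l| |]; lra.
have lnK : ln K <= ln (2 * (1 + eta)) + tau * l n.
  have -> : tau * l n = ln (Rpower (INR n) tau) by rewrite /Rpower ln_exp.
  rewrite -ln_mult; [|lra|exact: exp_pos].
  apply: ln_le_mono => //; have := sparse n0.
  (* This absorbs the 1 in d + 1, giving d + 1 <= 2 n^tau. *)
  have : 1 <= Rpower (INR n) tau.
    by rewrite -[X in X <= _](Rpower_O (INR n)); [apply: Rle_Rpower|]; lra.
  by rewrite /K; nra.
have : ln L < 0 by rewrite -ln_1; apply: ln_increasing.
have -> : (1 + eta) * ((d n + 1) * D n) = K * D n by rewrite /K /d; ring.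
by rewrite lnL; lra.
Qed.

(** Take eta = delta / 2 and n so large that [C] is at most half of [delta * l n]. [M] is a floor
    for ln n that later permits division by it. *)
Lemma recovery_degree_asymptotic delta M : 0 < delta ->
  exists N : nat, forall n, (N <= n)%nat ->
    [/\ 0 <= d n, M <= l n & (1 - 3 * tau / 2 - delta) * l n <= (d n + 1) * D n].
Proof.
move=> delta0; have eta0 : 0 < delta / 2 by lra.
have [C [N1 bound]] := recovery_degree_bound eta0.
have [N2 large] := ln_INR_eventually_ge (Rmax M (Rmax 1 (2 * C / delta))).
exists (maxn 1 (maxn N1 N2)) => n; rewrite !geq_max => /and3P[n0 /bound {}bound /large].
rewrite -/(l n) => {}large.
have lM : M <= l n by apply: Rle_trans large; apply: Rmax_l.
have l1 : 1 <= l n.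
  by apply: Rle_trans large; apply: Rle_trans (Rmax_r _ _); apply: Rmax_l.
have lC : 2 * C <= delta * l n.
  have : 2 * C / delta <= l n.
    by apply: Rle_trans large; apply: Rle_trans (Rmax_r _ _); apply: Rmax_r.
  move=> /(Rmult_le_compat_l delta _ _ (Rlt_le _ _ delta0)).
  by have -> : delta * (2 * C / delta) = 2 * C by field; lra.
split=> //; first exact: avg_degree_ge0.
(* With a = 1 - 3 tau / 2 < 1, the product (1 + delta / 2)(a - delta) is below a - delta / 2, which
   contradicts [bound]. *)
apply: Rnot_lt_le => lt.
have := Rmult_lt_compat_l (1 + delta / 2) _ _ ltac:(lra) lt.
have p1 : 0 < delta * l n by nra.
have p2 : 0 < delta * (delta * l n) by nra.
have p3 : 0 < tau * (delta * l n) by nra.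
by nra.
Qed.

End Asymptotics.

(** With u = (1 - 2 eps)^2 one has 1 - u = exp(-2D); multiply exp(2D) >= 1 + 2D by it. The bound is
    asymptotically sharp, as D ~ u / 2 when eps tends to 1/2. *)
Lemma KL_half_le eps : 0 < eps < / 2 ->
  2 * KL_half eps * (1 - (1 - 2 * eps) ^ 2) <= (1 - 2 * eps) ^ 2.
Proof.
move=> e2; set D := KL_half eps; set u := (1 - 2 * eps) ^ 2.
have uE : 1 - u = exp (- (2 * D)) by rewrite exp_KL_half /u; lra.
have := exp_ineq1_le (2 * D); have := exp_pos (- (2 * D)).
have : exp (- (2 * D)) * exp (2 * D) = 1 by rewrite -exp_plus Rplus_opp_l exp_0.
by rewrite -uE; nra.
Qed.

(* [Rmin 0 (f n - g n)] is the largest admissible error term. *)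
Lemma exists_error_term (f g w : nat -> R) :
  (forall n, 0 < w n) ->
  (forall delta, 0 < delta -> exists N : nat, forall n, (N <= n)%nat ->
     - delta <= (f n - g n) * w n) ->
  exists r : nat -> R, Un_cv (fun n => r n * w n) 0 /\
    exists N : nat, forall n : nat, (N <= n)%nat -> f n >= g n + r n.
Proof.
move=> w0 fg; exists (fun n => Rmin 0 (f n - g n)); split; last first.
  by exists 0%nat => n _; have := Rmin_r 0 (f n - g n); lra.
move=> e e0; have [|N fgN] := fg (e / 2); first by lra.
exists N => n /leP/fgN fgn; rewrite /Rdist Rminus_0_r; have := w0 n.
rewrite /Rmin; case: Rle_dec => [_|/Rnot_le_lt neg] wn; apply: Rabs_def1; nra.
Qed.

Theorem theorem1 (G : forall n : nat, rel 'I_n) (eps : nat -> R) (tau : R) :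
  (forall n, simple_graph (G n)) ->
  (forall n, 0 < eps n < / 2) ->
  0 < tau < 2 / 3 ->
  (forall n, (0 < n)%nat -> avg_degree (G n) <= Rpower (INR n) tau) ->
  exact_recovery_whp G eps ->
  (exists r : nat -> R,
     Un_cv (fun n => r n * KL_half (eps n)) 0 /\
     exists N : nat, forall n : nat, (N <= n)%nat ->
       avg_degree (G n) / ln (INR n) >=
       (1 - 3 * tau / 2) / KL_half (eps n) - 1 / ln (INR n) + r n)
  /\
  (Un_cv eps (/ 2) ->
   exists r : nat -> R,
     Un_cv (fun n => r n * (1 - 2 * eps n) ^ 2) 0 /\
     exists N : nat, forall n : nat, (N <= n)%nat ->
       avg_degree (G n) / ln (INR n) >=
       2 * (1 - 3 * tau / 2) / (1 - 2 * eps n) ^ 2 + r n).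
Proof.
move=> _ eps_half tau_range sparse recovery.
have asym := recovery_degree_asymptotic eps_half tau_range sparse recovery.
have D0 n := KL_half_pos (eps_half n).
split=> [|eps_cv].
  apply: exists_error_term => // delta delta0.
  have [N asymN] := asym delta 1 delta0; exists N => n /asymN[_ l1 le].
  have Dn := D0 n; set D := KL_half _ in le Dn *; set l := ln _ in l1 le *.
  apply: (Rmult_le_reg_r l); first by lra.
  set d := avg_degree _ in le *.
  (* The term -1 / ln n is exactly what restores the 1 in d + 1. *)
  have -> : (d / l - ((1 - 3 * tau / 2) / D - 1 / l)) * D * l =
    (d + 1) * D - (1 - 3 * tau / 2) * l by field; lra.
  by lra.
have u0 n : 0 < (1 - 2 * eps n) ^ 2 by apply: pow_lt; have := eps_half n; lra.
apply: exists_error_term => // delta delta0.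
have [|N1 asymN] := asym (delta / 4) 1; first by lra.
(* With kappa this minimum, u <= 4 kappa^2 <= 2 kappa <= delta / 12. *)
have [|N2 cvN] := eps_cv (Rmin (/ 2) (delta / 24)).
  by apply: Rmin_pos; lra.
exists (maxn N1 N2) => n; rewrite geq_max => /andP[/asymN[d0 l1 le] /leP/cvN].
have := Rmin_l (/ 2) (delta / 24); have := Rmin_r (/ 2) (delta / 24).
set kappa := Rmin _ _; rewrite /Rdist => k1 k2 /Rabs_def2[_ close].
have := KL_half_le (eps_half n); have := eps_half n; have := u0 n.
have Dn := D0 n; set D := KL_half _ in le Dn *; set l := ln _ in l1 le *.
set d := avg_degree _ in d0 le *; set u := (_ ^ 2) => up en Du.
have u_small : u <= delta / 12 /\ u < 1.
  have : u <= (2 * kappa) ^ 2 by apply: pow_incr; lra.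
  by split; [nra|rewrite /u; nra].
apply: (Rmult_le_reg_r l); first by lra.
have -> : (d / l - 2 * (1 - 3 * tau / 2) / u) * u * l =
    d * u - 2 * (1 - 3 * tau / 2) * l by field; lra.
(* D is traded for u through [KL_half_le]. The losses from 1 - u and from d + 1 are of order u l and
   u, absorbed by delta l since l >= 1. *)
have h1 : 2 * ((1 - 3 * tau / 2 - delta / 4) * l) * (1 - u) <= (d + 1) * u.
  apply: (Rle_trans _ (2 * ((d + 1) * D) * (1 - u))); first by nra.
  by have := Rmult_le_compat_l (d + 1) _ _ ltac:(lra) Du; lra.
have p1 : u * l <= delta / 12 * l by nra.
have p2 : 0 < tau * (u * l) by apply: Rmult_lt_0_compat; nra.
have p3 : 0 < delta * (u * l) by apply: Rmult_lt_0_compat; nra.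
by nra.
Qed.
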